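(* Let $N\ge 1$, let $g:\mathbb R^N\to[0,\infty)$ be a non-trivial bounded non-negative function, and let $u=u(x,t)$ be the unique bounded solution of the Cauchy problem $$\partial_t u=\Delta u\ \text{ in } \mathbb R^N\times(0,+\infty),\qquad u=g\ \text{ on } \mathbb R^N\times\{0\}.$$ Let $G_0$ be the support of $g$ and suppose that $G_0$ is a compact set. Suppose that there exists a bounded domain $\Omega$ in $\mathbb R^N$ with $C^1$ boundary $\partial\Omega$ and with $G_0\cup\{0\}\subset\Omega$ such that the following condition holds: there exist two sequences of positive numbers $\{t_n\}_{n=1}^\infty$ and $\{a_n\}_{n=1}^\infty$ such that $t_n\uparrow\infty$ as $n\uparrow\infty$ and $$u(t_nx,t_n)=a_n\quad\text{for all } n\in\mathbb N \text{ and } x\in\partial\Omega.$$ Then $u$ must be radially symmetric with respect to the origin.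
   Context: A domain is a connected open set. For $N=1$, a bounded domain is a bounded open interval $(a,b)$ with boundary $\{a,b\}$. ''Non-trivial'' means that $g$ is not (almost everywhere) identically zero. The unique bounded solution is $$u(x,t)=(4\pi t)^{-N/2}\int_{\mathbb R^N}e^{-|x-y|^2/(4t)}g(y)\,dy\qquad (x\in\mathbb R^N,\ t>0).$$ ''$u$ is radially symmetric with respect to the origin'' means that $u(x,t)=u(Ax,t)$ for every $N\times N$ real orthogonal matrix $A$ and all $(x,t)\in\mathbb R^N\times(0,\infty)$. *)

(* Defs.v *)
From HB Require Import structures.
From mathcomp Require Import all_boot all_order all_algebra.
From mathcomp Require Import all_classical all_reals all_analysis.
From mathcomp Require Import measurable_realfun.

Set Implicit Arguments.
Unset Strict Implicit.
Unset Printing Implicit Defensive.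
Import Order.TTheory GRing.Theory Num.Theory.
Import numFieldNormedType.Exports.
Local Open Scope classical_set_scope.
Local Open Scope ring_scope.

(* The n-fold product sigma-algebra on row vectors: for T = R this is the Borel
   sigma-algebra of R^n. *)

Definition measure_rV_display : measure_display -> measure_display.
Proof. exact. Qed.

Section measurable_rV.
Context {d} {T : measurableType d}.
Variable n : nat.

Let coors : 'I_n -> 'rV[T]_n -> T := fun i v => v ord0 i.

Let rV_set0 : g_sigma_preimage coors set0.
Proof. exact: sigma_algebra0. Qed.

Let rV_setC A : g_sigma_preimage coors A -> g_sigma_preimage coors (~` A).
Proof. exact: sigma_algebraC. Qed.

Let rV_bigcup (F : _^nat) : (forall i, g_sigma_preimage coors (F i)) ->
  g_sigma_preimage coors (\bigcup_i (F i)).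
Proof. exact: sigma_algebra_bigcup. Qed.

HB.instance Definition _ := @isMeasurable.Build (measure_rV_display d)
  'rV[T]_n (g_sigma_preimage coors) rV_set0 rV_setC rV_bigcup.

End measurable_rV.

Lemma measurable_coord_rV d (T : measurableType d) n (i : 'I_n) :
  measurable_fun [set: 'rV[T]_n] (fun v : 'rV[T]_n => v ord0 i).
Proof.
move=> _ Y mY; rewrite setTI; apply: sub_sigma_algebra => /=.
rewrite -bigcup_seq/=; exists i => /=; first by rewrite mem_index_enum.
by exists Y => //; rewrite setTI.
Qed.

Lemma measurable_fun_rVP d1 d2 (T1 : measurableType d1)
    (T2 : measurableType d2) n (f : T1 -> 'rV[T2]_n) :
  measurable_fun [set: T1] f <->
  forall i, measurable_fun [set: T1] (fun x => f x ord0 i).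
Proof.
split=> [mf i|mf].
  exact: (measurableT_comp (measurable_coord_rV i) mf).
pose coors := fun i (v : 'rV[T2]_n) => v ord0 i.
suff prefS : g_sigma_preimage (fun i => coors i \o f) `<=` measurable.
  move=> _ A mA; apply: prefS; rewrite g_sigma_preimage_comp.
  by exists A.
apply: smallest_sub; first exact: sigma_algebra_measurable.
case: n => [|n] in f mf coors *; first by rewrite big_ord0.
rewrite -bigcup_mkord_ord; apply: bigcup_sub => i Ii.
by move=> A [B mB <-]; exact: (mf _ _ _ mB).
Qed.

Section lebesgue_rV.
Context {R : realType}.

Definition cons_rV n (p : measurableTypeR R * 'rV[R]_n) : 'rV[R]_n.+1 :=
  row_mx (\row_(_ < 1) p.1) p.2.

Definition uncons_rV n (v : 'rV[R]_n.+1) : measurableTypeR R * 'rV[R]_n :=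
  (v ord0 ord0, \row_i v ord0 (lift ord0 i)).

Lemma cons_rVK n : cancel (@cons_rV n) (@uncons_rV n).
Proof.
move=> [x v]; rewrite /uncons_rV /cons_rV /=; congr pair.
  by rewrite mxE; case: splitP => // j _; rewrite mxE.
apply/rowP => i; rewrite !mxE; case: splitP => [j|k].
  by rewrite [j]ord1.
by rewrite lift0 add1n => -[/ord_inj ->].
Qed.

Lemma measurable_cons_rV n : measurable_fun [set: measurableTypeR R * 'rV[R]_n] (@cons_rV n).
Proof.
apply/measurable_fun_rVP => i; rewrite /cons_rV.
under eq_fun do rewrite mxE.
case: (@fintype.split 1 n i) => j.
  by under eq_fun do rewrite mxE; exact: measurable_fst.
exact: (measurableT_comp (measurable_coord_rV j) measurable_snd).
Qed.

Lemma measurable_uncons_rV n : measurable_fun setT (@uncons_rV n).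
Proof.
apply/measurable_fun_pairP; split; first exact: measurable_coord_rV.
apply/measurable_fun_rVP => i; rewrite /uncons_rV /=.
under eq_fun do rewrite mxE; exact: measurable_coord_rV.
Qed.

Section succ.
Variables (n : nat) (m : {sigma_finite_measure set 'rV[R]_n -> \bar R}).

Definition lebesgue_rV_succ : set 'rV[R]_n.+1 -> \bar R :=
  pushforward (lebesgue_measure \x m)%E (@cons_rV n).

Let preimage_cons A : measurable A -> measurable (@cons_rV n @^-1` A).
Proof.
by move=> mA; rewrite -[X in measurable X]setTI; exact: measurable_cons_rV.
Qed.

Let lebesgue_rV_succ0 : lebesgue_rV_succ set0 = 0%E.
Proof. by rewrite /lebesgue_rV_succ /pushforward preimage_set0 measure0. Qed.

Let lebesgue_rV_succ_ge0 A : (0 <= lebesgue_rV_succ A)%E.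
Proof. exact: (measure_ge0 (lebesgue_measure \x m)%E). Qed.

Let lebesgue_rV_succ_sigma_additive : semi_sigma_additive lebesgue_rV_succ.
Proof.
move=> F mF tF mUF; rewrite /lebesgue_rV_succ /pushforward preimage_bigcup.
apply: measure_semi_sigma_additive; last by rewrite -preimage_bigcup; exact: preimage_cons.
  by move=> k; exact: preimage_cons.
apply/trivIsetP => i j _ _ ij; rewrite -preimage_setI.
by move/trivIsetP : tF => /(_ _ _ Logic.I Logic.I ij) ->; rewrite preimage_set0.
Qed.

HB.instance Definition _ := isMeasure.Build _ _ _ lebesgue_rV_succ
  lebesgue_rV_succ0 lebesgue_rV_succ_ge0 lebesgue_rV_succ_sigma_additive.

Let lebesgue_rV_succ_sigma_finite : sigma_finite setT lebesgue_rV_succ.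
Proof.
have /sigma_finiteP[F [TF ndF Foo]] := sigma_finiteT (@lebesgue_measure R).
have /sigma_finiteP[G [TG ndG Goo]] := sigma_finiteT m.
exists (fun k => @uncons_rV n @^-1` (F k `*` G k)).
  rewrite -preimage_bigcup (_ : \bigcup_k _ = setT) ?preimage_setT//.
  rewrite -setXTT TF TG predeqE => -[x y]; split.
    by move=> [k _ []/= ? ?]; split; exists k.
  move=> [/= [k _ Fkx] [l _ Gly]]; exists (maxn k l) => //; split.
  - by move: x Fkx; exact/subsetPset/ndF/leq_maxl.
  - by move: y Gly; exact/subsetPset/ndG/leq_maxr.
move=> k; have [mF Fk] := Foo k; have [mG Gk] := Goo k; split.
  rewrite -[X in measurable X]setTI; apply: measurable_uncons_rV => //.
  exact: measurableX.
rewrite /lebesgue_rV_succ /pushforward -comp_preimage.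
rewrite (_ : _ \o _ = id); last by apply/funext => p /=; rewrite cons_rVK.
by rewrite preimage_id product_measure1E// lte_mul_pinfty// ge0_fin_numE.
Qed.

HB.instance Definition _ := Measure_isSigmaFinite.Build _ _ _
  lebesgue_rV_succ lebesgue_rV_succ_sigma_finite.

End succ.

Fixpoint lebesgue_rV n : {sigma_finite_measure set 'rV[R]_n -> \bar R} :=
  match n with
  | 0 => \d_(0 : 'rV[R]_0)
  | n'.+1 => lebesgue_rV_succ (lebesgue_rV n')
  end.

Lemma lebesgue_rV_box n (B : 'I_n -> set (measurableTypeR R)) :
  (forall i, measurable (B i)) ->
  lebesgue_rV n [set v | forall i, B i (v ord0 i)] =
  (\prod_(i < n) lebesgue_measure (B i))%E.
Proof.
elim: n B => [|n IHn] B mB.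
  rewrite big_ord0 /= diracE mem_set//; by case.
rewrite big_ord_recl -IHn//= /lebesgue_rV_succ /pushforward.
rewrite -product_measure1E//; last first.
  rewrite [X in measurable X](_ : _ =
      \bigcap_(i in [set: 'I_n]) ((fun v : 'rV[R]_n => v ord0 i) @^-1`
        B (lift ord0 i))).
    apply: fin_bigcap_measurable => // i _; rewrite -[X in measurable X]setTI.
    by apply: measurable_coord_rV => //; exact: mB.
  by apply/seteqP; split=> v /= Bv i; [move=> _|]; exact: Bv.
congr (product_measure1 _ _ _); apply/seteqP; split=> p /=.
  move=> Bp; have := @cons_rVK n p; case: p Bp => x v Bp [xE vE].
  split=> [|i]; first by rewrite -[x]xE; exact: Bp.
  by rewrite -[v]vE mxE; exact: Bp.
have := @cons_rVK n p; case: p => x v [xE vE] [/= Bx Bv] i.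
have [j ->|->] := unliftP ord0 i; last by rewrite xE.
by have := Bv j; rewrite -{1}[v]vE mxE.
Qed.

End lebesgue_rV.

Section analysis_rV.
Context {R : realType} {n : nat}.
Implicit Types (x y v : 'rV[R]_n) (f : 'rV[R]_n -> R) (D : set 'rV[R]_n).

(* The library norm on 'rV[R]_n is the sup norm, so the Euclidean structure is
   spelled out. *)
Definition dotrV x y : R := \sum_i x ord0 i * y ord0 i.

Definition sqnorm x : R := dotrV x x.

(* Measurability for the completed (Lebesgue) sigma-algebra. The integral of the
   library, a supremum over Borel simple functions, is still the Lebesgue
   integral for such a function when it is nonnegative. *)
Definition lebesgue_measurable_fun f :=
  forall B : set R, measurable B ->
    completed_algebra_gen (lebesgue_rV n) (f @^-1` B).

(* The complement of the largest open set on which f = 0 almost everywhere; it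
   does not depend on the representative of f. *)
Definition ess_support f : set 'rV[R]_n :=
  [set x | forall U, nbhs x U ->
    ~ {ae lebesgue_rV n, forall y, U y -> f y = 0}].

Lemma ess_support_subset f : ess_support f `<=` closure [set x | f x != 0].
Proof.
move=> x fx U xU; apply: contrapT => fU0; apply: (fx U xU).
by apply: aeW => y Uy; apply: contrapT => /eqP fy0; apply: fU0; exists y.
Qed.

Definition domain D := open D /\ connected D.

Definition boundary D : set 'rV[R]_n := closure D `\` interior D.

Definition C1 f :=
  (forall x, differentiable f x) /\ (forall v, continuous (fun x => 'd f x v)).

(* Near each boundary point, D is the part of R^n lying strictly above the graph
   of a C^1 function over a hyperplane nu^\perp. The function is extended to R^n
   but only its values on nu^\perp matter; for n = 1 that hyperplane is a
   point. *)
Definition C1_boundary D :=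
  forall p, boundary D p -> exists (nu : 'rV[R]_n) (gamma : 'rV[R]_n -> R) (r : R),
    [/\ sqnorm nu = 1, C1 gamma, 0 < r &
      forall x, sqnorm (x - p) < r ^+ 2 ->
        (D x <-> gamma (x - dotrV x nu *: nu) < dotrV x nu)].

(* The bounded solution of the heat equation with initial datum g, for t > 0. *)
Definition heat_solution (g : 'rV[R]_n -> R) x (t : R) : R :=
  (4 * pi * t) `^ (- (n%:R / 2)) *
  \int[lebesgue_rV n]_y (expR (- (sqnorm (x - y) / (4 * t))) * g y).

(* x is a row vector, so x *m A^T is the usual A x. *)
Definition radially_symmetric (u : 'rV[R]_n -> R -> R) :=
  forall A : 'M[R]_n, A^T *m A = 1%:M ->
    forall x (t : R), 0 < t -> u x t = u (x *m A^T) t.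

End analysis_rV.

(* Main.v *)
Require Import Defs.
From HB Require Import structures.
From mathcomp Require Import all_boot all_order all_algebra.
From mathcomp Require Import all_classical all_reals all_analysis.
From mathcomp Require Import measurable_realfun ring lra.

Set Implicit Arguments.
Unset Strict Implicit.
Unset Printing Implicit Defensive.
Import Order.TTheory GRing.Theory Num.Theory.
Import numFieldNormedType.Exports.
Local Open Scope classical_set_scope.
Local Open Scope ring_scope.

(* Writing V(z, s) for the integral of exp(z.y - s|y|^2) g(y) dy, one has
   u(tx, t) = c(t) exp(-t|x|^2/4) V(x/2, 1/(4t)). Letting t -> oo in the level
   condition shows that |x| is constant on the boundary of Omega; since every
   ray from 0 leaves Omega, that boundary is a whole sphere |x| = rho.

   For A orthogonal put W(z, s) = V(z, s) - V(A z, s). It vanishes on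
   |z| = rho/2 for s = 1/(4 t_n), hence, being entire in s, for all s. As
   d/ds W = - Laplacian W and W is bounded for s >= 0 on the ball, W is a bounded
   ancient solution (in the time -s) of the heat equation with zero boundary
   values, so W = 0 on the ball by the maximum principle, and then everywhere by
   analyticity along rays. Derivatives are avoided throughout: finite differences
   of V and Taylor bounds on exp suffice. *)

(** * Null sets and completion-measurable functions *)

Section null_sets.
Context d (T : measurableType d) (R : realType) (mu : {measure set T -> \bar R}).
Local Open Scope ereal_scope.
Import HBNNSimple.

(** [F] may fail to be measurable, so the argument works with the definition of the integral as a
    supremum over simple functions below [F]: cutting such a function off on [Z] does not change its
    integral. *)
Lemma ge0_integral_setC_null (Z : set T) (F : T -> \bar R) :
  measurable Z -> mu Z = 0 -> (forall x, 0 <= F x) ->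
  \int[mu]_x F x = \int[mu]_(x in ~` Z) F x.
Proof.
move=> mZ Z0 F0; have mZC := measurableC mZ.
rewrite [RHS]integral_mkcond.
have FZ0 x : 0 <= (F \_ (~` Z)) x by rewrite erestrict_ge0.
rewrite !ge0_integralTE//; apply/eqP; rewrite eq_le; apply/andP; split.
  apply: ge_ereal_sup => _ [h /= hF <-].
  apply: ereal_sup_ubound; exists (proj_nnsfun h mZC).
    move=> x /=; rewrite mindicE patchE; case: ifPn => xZ.
      by rewrite mulr1.
    by rewrite mulr0.
  rewrite -!integralT_nnsfun [RHS](ge0_negligible_integral mZ)//=; last 2 first.
  - by apply/measurable_EFinP.
  - by move=> x _; rewrite lee_fin fun_ge0.
  rewrite setTD [RHS]integral_mkcond; apply: eq_integral => x _.
  rewrite mindicE patchE; case: ifPn => xZ; first by rewrite mulr1.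
  by rewrite mulr0.
apply: ge_ereal_sup => _ [h /= hF <-].
apply: ereal_sup_ubound; exists h => // x /=.
apply: le_trans (hF x) _; rewrite patchE; case: ifPn => // _; exact: F0.
Qed.

Lemma negligible_bigcup_count (I : countType) (F : I -> set T) :
  (forall i, mu.-negligible (F i)) -> mu.-negligible (\bigcup_i F i).
Proof.
move=> F0; pose G k := if unpickle k is Some i then F i else set0.
apply: (negligibleS (A := \bigcup_k G k)).
  by move=> x [i _ Fix]; exists (pickle i) => //; rewrite /G pickleK.
apply: negligible_bigcup => k; rewrite /G.
by case: unpickle => [i|]; [exact: F0|exact: negligible_set0].
Qed.

(* Off a Borel null set absorbing the null parts of the countably many sets
   [set x | f x < q], q rational, a completion-measurable function is Borel. *)
Lemma completed_measurable_fun_null (f : T -> R) :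
  (forall B : set R, measurable B -> completed_algebra_gen mu (f @^-1` B)) ->
  exists Z0, [/\ measurable Z0, mu Z0 = 0 &
    forall Z, measurable Z -> Z0 `<=` Z ->
      measurable_fun setT (fun x => f x * \1_(~` Z) x)%R].
Proof.
move=> mf.
have lt_split (q : rat) : exists AN : set T * set T,
    [/\ measurable AN.1, mu.-negligible AN.2 &
        AN.1 `|` AN.2 = f @^-1` `]-oo, ratr q[ ].
  have [|A mA [N N0 ANE]] := mf `]-oo, ratr q[%classic.
    exact: measurable_itv.
  by exists (A, N).
pose AN q := sval (cid (lt_split q)).
have mAN q : measurable (AN q).1 by rewrite /AN; case: cid => ? [].
have nAN q : mu.-negligible (AN q).2 by rewrite /AN; case: cid => ? [].
have ANE q : (AN q).1 `|` (AN q).2 = f @^-1` `]-oo, ratr q[.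
  by rewrite /AN; case: cid => ? [].
have [Z0 [mZ0 Z00 NZ0]] : mu.-negligible (\bigcup_q (AN q).2).
  exact: negligible_bigcup_count.
exists Z0; split => // Z mZ Z0Z.
apply: (measurability _ (RGenInftyO.measurableE R)).
move=> _ [_ [x ->] <-]; rewrite setTI.
(* Off [Z] the product is [f], and a rational lies between [f y] and [x]; on [Z] it is 0, which is
   below [x] exactly when [0 < x]. *)
rewrite (_ : _ @^-1` _ = (\bigcup_(q in [set q | ratr q < x]%R) ((AN q).1 `\` Z))
    `|` (if (0 < x)%R then Z else set0)).
  apply: measurableU; last by case: ifP.
  rewrite bigcup_mkcond; apply: bigcupT_measurable_rat => q.
  by case: ifP => // _; exact: measurableD.
apply/seteqP; split => y /=.
  rewrite in_itv/= indicE; have [yZ|yZ] := boolP (y \in ~` Z).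
    rewrite mulr1 => fyx; left.
    have [q] := rat_in_itvoo fyx.
    rewrite in_itv/= => /andP[fyq qx]; exists q => //; split; last first.
      by move: yZ; rewrite inE.
    have : (f @^-1` `]-oo, ratr q[) y by rewrite /= in_itv.
    rewrite -ANE => -[//|yN]; exfalso.
    by move: yZ; rewrite inE; apply; apply: Z0Z; apply: NZ0; exists q.
  rewrite mulr0 => ->; right.
  by move: yZ; rewrite notin_setE/= => /contrapT.
rewrite in_itv/= indicE; case=> [[q /= qx [yA yZ]]|].
  rewrite mem_set// mulr1; apply: lt_trans qx.
  have : ((AN q).1 `|` (AN q).2) y by left.
  by rewrite ANE /= in_itv.
by case: ifPn => // x0 yZ; rewrite memNset ?mulr0.
Qed.

End null_sets.

(** * Euclidean structure and Borel representatives *)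

Section euclidean.
Context {R : realType} {N : nat}.
Implicit Types (x y z : 'rV[R]_N).

Lemma coord_le_norm x i : `|x ord0 i| <= `|x|.
Proof.
rewrite [leRHS]/Num.Def.normr/= mx_normrE.
by apply/bigmax_geP; right => /=; exists (ord0, i).
Qed.

Lemma sqnorm_ge0 x : 0 <= sqnorm x.
Proof. by apply: sumr_ge0 => i _; rewrite -expr2 sqr_ge0. Qed.

Lemma dotrVE x y : dotrV x y = (x *m y^T) ord0 ord0.
Proof. by rewrite mxE; apply: eq_bigr => i _; rewrite mxE. Qed.

Lemma dotrVDl x y z : dotrV (x + y) z = dotrV x z + dotrV y z.
Proof. by rewrite !dotrVE mulmxDl mxE. Qed.

Lemma dotrVZl c x y : dotrV (c *: x) y = c * dotrV x y.
Proof. by rewrite !dotrVE -scalemxAl mxE. Qed.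

Lemma dotrVC x y : dotrV x y = dotrV y x.
Proof. by apply: eq_bigr => i _; rewrite mulrC. Qed.

Lemma dotrV_delta i y : dotrV (delta_mx ord0 i) y = y ord0 i.
Proof. by rewrite dotrVE -rowE !mxE. Qed.

Lemma dotrV_mulmx_tr (A : 'M[R]_N) x y : dotrV (x *m A^T) y = dotrV x (y *m A).
Proof. by rewrite !dotrVE trmx_mul mulmxA. Qed.

Lemma sqnormD x y : sqnorm (x + y) = sqnorm x + 2 * dotrV x y + sqnorm y.
Proof.
rewrite /sqnorm !dotrVDl !(dotrVC _ (x + y)) !dotrVDl (dotrVC y x).
ring.
Qed.

Lemma sqnormZ c x : sqnorm (c *: x) = c ^+ 2 * sqnorm x.
Proof. by rewrite /sqnorm dotrVZl dotrVC dotrVZl mulrA. Qed.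

Lemma sqnorm_delta i : sqnorm (delta_mx ord0 i : 'rV[R]_N) = 1.
Proof. by rewrite /sqnorm dotrV_delta mxE !eqxx. Qed.

Lemma sqnorm_shift x i c :
  sqnorm (x + c *: delta_mx ord0 i) = sqnorm x + 2 * c * x ord0 i + c ^+ 2.
Proof.
rewrite sqnormD sqnormZ sqnorm_delta dotrVC dotrVZl dotrV_delta.
by rewrite mulr1 mulrA.
Qed.

Lemma sqr_coord_le x i : x ord0 i ^+ 2 <= sqnorm x.
Proof.
rewrite /sqnorm /dotrV (bigD1 i)//= expr2 lerDl.
by apply: sumr_ge0 => j _; rewrite -expr2 sqr_ge0.
Qed.

Lemma sqnorm_mulmx_orth (A : 'M[R]_N) x : A *m A^T = 1%:M ->
  sqnorm (x *m A) = sqnorm x.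
Proof.
by move=> AA; rewrite /sqnorm -dotrV_mulmx_tr -mulmxA AA mulmx1.
Qed.

(** The hypothesis concerns the sup norm, so the sum is at most [N * K ^+ 2]; the factor [N.+1]
    makes the bound a square without extracting a root. *)
Lemma sqnorm_le x (K : R) : `|x| <= K -> sqnorm x <= (N.+1%:R * K) ^+ 2.
Proof.
move=> xK; have K0 : 0 <= K by apply: le_trans xK.
apply: (@le_trans _ _ (\sum_(i < N) K ^+ 2)).
  apply: ler_sum => i _; rewrite -expr2 -real_normK ?num_real// lerXn2r ?nnegrE//.
  exact: le_trans (coord_le_norm _ _) xK.
rewrite sumr_const card_ord exprMn -[leLHS]mulr_natl ler_wpM2r ?sqr_ge0//.
by rewrite -natrX ler_nat (leq_trans (leqnSn N))// expnS expn1 leq_pmull.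
Qed.

Lemma measurable_dotrV z : measurable_fun setT (dotrV z).
Proof.
apply: measurable_sum => i; apply: measurable_funM => //.
exact: measurable_coord_rV.
Qed.

Lemma measurable_sqnorm : measurable_fun setT (@sqnorm R N).
Proof.
by apply: measurable_sum => i; apply: measurable_funM;
  exact: measurable_coord_rV.
Qed.

(** A Lindelöf argument: each point off the support lies in a ball with rational centre and radius
    1/(n+1) on which [g] vanishes almost everywhere, and there are countably many such balls. *)
Lemma ess_support_negligible (g : 'rV[R]_N -> R) :
  (lebesgue_rV N).-negligible [set y | g y != 0 /\ ~ ess_support g y].
Proof.
pose U (qn : 'rV[rat]_N * nat) :=
  ball (map_mx ratr qn.1 : 'rV[R]_N) (qn.2.+1%:R^-1 : R).
pose P qn := {ae lebesgue_rV N, forall y, U qn y -> g y = 0}.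
pose F qn := if asbool (P qn) then U qn `&` [set y | g y != 0] else set0.
apply: (negligibleS (A := \bigcup_qn F qn)); last first.
  apply: negligible_bigcup_count => qn; rewrite /F; case: asboolP => [Pqn|_].
    apply: negligibleS Pqn => y [Uy gy] /= /(_ Uy) gy0.
    by move: gy; rewrite /= gy0 eqxx.
  exact: negligible_set0.
move=> y [gy0 /existsNP[V /not_implyP[/nbhs_ballP[e /= e0 yeV]]]].
move=> /contrapT gV.
(* With radius below [e / 2], a ball whose centre is within that radius of [y] stays inside the
   [e]-ball around [y]. *)
have [n] := ltr_add_invr (divr_gt0 e0 (ltr0Sn R 1)); rewrite add0r => ne.
pose r : R := n.+1%:R^-1; have r0 : 0 < r by rewrite invr_gt0.
have qP i : exists q : rat, y ord0 i - r < ratr q < y ord0 i + r.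
  have [|q] := @rat_in_itvoo R (y ord0 i - r) (y ord0 i + r).
    by lra.
  by rewrite in_itv/=; exists q.
pose q : 'rV[rat]_N := \row_i sval (cid (qP i)).
have qE i : y ord0 i - r < ratr (q ord0 i) < y ord0 i + r.
  by rewrite mxE; case: cid.
have Uy : U (q, n) y.
  split=> // i j; rewrite [i]ord1 mxE /ball/= ltr_norml.
  by have := qE j; rewrite -/r; lra.
have UV : U (q, n) `<=` V.
  move=> z [_ Uz]; apply: yeV; split => // i j; move: (Uz i j) (qE j).
  rewrite [i]ord1 mxE /ball/= !ltr_norml -/r => {}Uz qj.
  by move: ne; rewrite -/r ltr_pdivlMr//; lra.
exists (q, n) => //; rewrite /F; case: asboolP => [_|]; first by split.
move=> nP; exfalso; apply: nP; apply: negligibleS gV => z /= + Vz.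
by apply => /UV /Vz.
Qed.

Lemma lebesgue_rV_cube_fin (K : R) :
  (lebesgue_rV N [set v : 'rV[R]_N | forall i, v ord0 i \in `[- K, K]%R] < +oo)%E.
Proof.
rewrite (lebesgue_rV_box (B := fun=> `[- K, K]%classic)); last first.
  by move=> i; exact: measurable_itv.
rewrite ltey_eq; apply/orP; left.
apply: (big_ind (fun x : \bar R => x \is a fin_num)) => // [x y|i _].
  exact: fin_numM.
by rewrite lebesgue_measure_itv; case: ifP.
Qed.

Lemma measurable_cube (K : R) :
  measurable [set v : 'rV[R]_N | forall i, v ord0 i \in `[- K, K]%R].
Proof.
rewrite [X in measurable X](_ : _ = \bigcap_(i in [set: 'I_N])
    ((fun v : 'rV[R]_N => v ord0 i) @^-1` `[- K, K])).
  apply: fin_bigcap_measurable => // i _; rewrite -[X in measurable X]setTI.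
  by apply: measurable_coord_rV => //; exact: measurable_itv.
by apply/seteqP; split=> v /= Bv i; [move=> _|]; exact: Bv.
Qed.

(** [f] is [g] set to 0 on a Borel null set that absorbs both the failure of Borel measurability and
    the points off the support where [g] is nonzero. From here on linearity of the integral is
    available. *)
Lemma exists_borel_datum (g : 'rV[R]_N -> R) :
  lebesgue_measurable_fun g -> (forall x, 0 <= g x) ->
  (exists M : R, forall x, g x <= M) ->
  ~ {ae lebesgue_rV N, forall x, g x = 0} -> compact (ess_support g) ->
  exists (f : 'rV[R]_N -> R) (L : R),
    [/\ (lebesgue_rV N).-integrable setT (EFin \o f),
        forall y, 0 <= f y, 0 <= L,
        forall y, f y != 0 -> sqnorm y <= L ^+ 2 &
        0 < \int[lebesgue_rV N]_y f y] /\
      (forall phi : 'rV[R]_N -> R, (forall y, 0 <= phi y) ->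
          \int[lebesgue_rV N]_y (phi y * g y) =
          \int[lebesgue_rV N]_y (phi y * f y)).
Proof.
move=> mg g0 [M gM] gN0 /compact_bounded[K0 [_ gK0]].
pose K := Num.max 1 (K0 + 1); have K_ge0 : 0 <= K by rewrite le_max ler01.
have gK y : ess_support g y -> `|y| <= K.
  by apply: gK0; rewrite lt_max ltrDl ltr01 orbT.
have [Z0 [mZ0 Z00 mf]] := completed_measurable_fun_null mg.
have [Z1 [mZ1 Z10 gZ1]] := ess_support_negligible g.
pose Z := Z0 `|` Z1; have mZ : measurable Z by exact: measurableU.
have Z_0 : lebesgue_rV N Z = 0%E by exact: null_set_setU.
pose f x := g x * \1_(~` Z) x.
have {}mf : measurable_fun setT f by apply: mf => // x Zx; left.
have f0 y : 0 <= f y by rewrite mulr_ge0.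
have fM y : f y <= M.
  rewrite /f indicE; case: (_ \in _); rewrite ?mulr1 ?mulr0//.
  exact: le_trans (g0 y) (gM y).
have fK y : f y != 0 -> `|y| <= K.
  rewrite /f indicE; have [yZ|yZ] := boolP (y \in _); last by rewrite mulr0 eqxx.
  rewrite mulr1 => gy0; apply: gK; apply: contrapT => yg.
  by move: yZ; rewrite inE; apply; right; exact: gZ1.
have intf : (lebesgue_rV N).-integrable setT (EFin \o f).
  pose C := [set v : 'rV[R]_N | forall i, v ord0 i \in `[- K, K]%R].
  have fC : (EFin \o f) \_ C = EFin \o f.
    apply/funext => y; rewrite patchE; case: ifPn => // yC /=.
    have [->//|/fK yK] := eqVneq (f y) 0.
    exfalso; move: yC; rewrite notin_setE; apply=> i /=.
    by rewrite in_itv/= -ler_norml (le_trans (coord_le_norm _ _)).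
  have mC : measurable C by exact: measurable_cube.
  rewrite -fC; apply/(integrable_mkcond _ mC).
  apply: measurable_bounded_integrable.
  - exact: mC.
  - exact: (lebesgue_rV_cube_fin K).
  - exact: measurable_funTS.
  - exists M; split; first exact: num_real.
    by move=> c Mc y _ /=; rewrite ger0_norm// (le_trans (fM y))// ltW.
exists f, (N.+1%:R * K); split; first split => //.
- by rewrite mulr_ge0.
- by move=> y /fK; exact: sqnorm_le.
- rewrite lt_neqAle Rintegral_ge0// andbT eq_sym; apply/eqP => If0.
  apply: gN0.
  have : (\int[lebesgue_rV N]_y `|(EFin \o f) y| = 0)%E.
    rewrite (eq_integral (EFin \o f)) => [|y _]; last by rewrite gee0_abs ?lee_fin.
    rewrite -[LHS]fineK; first by rewrite (_ : fine _ = 0).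
    exact: integrable_fin_num.
  case/ae_eq_integral_abs => //; first exact/measurable_EFinP.
  move=> A [mA A0 fA]; exists (A `|` Z); split; first exact: measurableU.
    exact: null_set_setU.
  move=> y /= gy; have [yZ|yZ] := pselect (Z y); [by right|left].
  apply: fA => /= /(_ Logic.I)[]; rewrite /f indicE mem_set// mulr1.
  exact: gy.
- move=> phi phi0; rewrite /Rintegral; congr fine.
  rewrite (ge0_integral_setC_null mZ Z_0); last first.
    by move=> x; rewrite lee_fin mulr_ge0.
  rewrite [RHS](ge0_integral_setC_null mZ Z_0); last first.
    by move=> x; rewrite lee_fin mulr_ge0.
  by apply: eq_integral => y yZ; rewrite /f indicE yZ mulr1.
Qed.

End euclidean.

(** * Functions of exponential type *)

Section exponential_type.
Context {R : realType}.
Implicit Types (x l : R) (F G : R -> R).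

(** As (n+i)! is at least n! i!, each tail term is dominated by |x|^n / n! times a term of the
    series of exp |x|; the bound then passes to the limit. *)
Lemma expR_taylor x n :
  `|expR x - \sum_(j < n) x ^+ j / j`!%:R| <= `|x| ^+ n / n`!%:R * expR `|x|.
Proof.
have cx := is_cvg_series_exp_coeff x.
have sE m : series (exp_coeff x) m = \sum_(j < m) x ^+ j / j`!%:R.
  by rewrite /series/= big_mkord.
have tail m : `|series (exp_coeff x) (n + m) - series (exp_coeff x) n|
    <= `|x| ^+ n / n`!%:R * expR `|x|.
  rewrite /series/= /exp_coeff/= (big_cat_nat (leq0n n) (leq_addr m n))/=.
  rewrite [X in `|X|]addrC addKr -{1}[n]add0n big_addn addKn big_mkord.
  apply: (le_trans (ler_norm_sum _ _ _)).
  apply: (@le_trans _ _ (\sum_(i < m) `|x| ^+ n / n`!%:R * (`|x| ^+ i / i`!%:R))).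
    apply: ler_sum => i _.
    rewrite normrM normrX normfV (ger0_norm (ler0n _ _)) addnC exprD.
    rewrite mulrACA ler_wpM2l ?mulr_ge0 ?exprn_ge0//.
    rewrite -invfM lef_pV2 ?posrE ?mulr_gt0 ?ltr0n ?fact_gt0//.
    rewrite -natrM ler_nat -(bin_fact (leq_addr i n)) addKn.
    by rewrite leq_pmull// bin_gt0 leq_addr.
  rewrite -mulr_sumr ler_wpM2l ?divr_ge0 ?exprn_ge0//.
  rewrite /expR; apply: (le_trans _ (nondecreasing_cvgn_le _ _ m)).
  - by rewrite /series/= big_mkord.
  - apply/nondecreasing_seqP => k; rewrite /series/= big_nat_recr//= lerDl.
    by rewrite /exp_coeff/= divr_ge0 ?exprn_ge0.
  - exact: is_cvg_series_exp_coeff.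
rewrite -sE; set S := series _ in cx sE tail *.
have cS : `|S k - S n| @[k --> \oo] --> `|expR x - S n|.
  by apply: cvg_norm; apply: cvgB; [exact: cx|exact: cvg_cst].
rewrite -(cvg_lim _ cS)//; apply: limr_le; first by apply/cvg_ex; eexists; exact: cS.
by exists n => //= k nk; rewrite -(subnKC nk); exact: tail.
Qed.

(** For [y <= x], the tangent inequality 1 + (y - x) <= exp (y - x) multiplied by exp x gives the
    bound. *)
Lemma expR_lip x y (K : R) : `|x| <= K -> `|y| <= K ->
  `|expR x - expR y| <= `|x - y| * expR K.
Proof.
wlog yx : x y / y <= x.
  move=> H xK yK; have [yx|/ltW xy] := leP y x; first exact: H.
  by rewrite distrC (distrC x); exact: H.
move=> xK _; have eyx : expR y <= expR x by rewrite ler_expR.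
rewrite !ger0_norm ?subr_ge0//.
apply: (@le_trans _ _ ((x - y) * expR x)).
  have := expR_ge1Dx (y - x); rewrite expRB ler_pdivlMr ?expR_gt0// => H.
  lra.
by rewrite ler_wpM2l ?subr_ge0// ler_expR (le_trans (ler_norm x)).
Qed.

(** A derivative-free form of being entire of exponential type: [m j] stands for the j-th derivative
    at 0, and the Taylor remainder is controlled at every order and every point. *)
Definition exp_type F := exists (m : nat -> R) (B L : R),
  forall l n, `|F l - \sum_(j < n) m j * (l ^+ j / j`!%:R)| <=
    B * ((L * `|l|) ^+ n / n`!%:R * expR (L * `|l|)).

(** Zeros accumulating at 0 kill the coefficients one by one, since the first nonzero one would
    dominate near 0. Then only the remainder is left, and it tends to 0 as the order grows. *)
Lemma exp_type_eq0 F : exp_type F ->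
  (forall e, 0 < e -> exists2 l, 0 < `|l| < e & F l = 0) -> forall l, F l = 0.
Proof.
move=> [m [B [L FmBL]]] F0.
have m0 k : m k = 0.
  elim/ltn_ind: k => k IH.
  apply/eqP; rewrite -normr_eq0 eq_le normr_ge0 andbT; apply/ler_addgt0Pr => e e0.
  (* For a zero [l] with [|l| < 1], dividing the order [k.+1] bound by |l|^k / k! leaves |m k| <= C
     |l|. *)
  rewrite add0r; pose C := `|B| * `|L| ^+ k.+1 * expR `|L|.
  have C0 : 0 <= C by rewrite !mulr_ge0 ?exprn_ge0 ?expR_ge0.
  have [|l /andP[l0 le] Fl] := F0 (Num.min 1 (e / (C + 1))).
    by rewrite lt_min ltr01 divr_gt0// ltr_wpDl.
  move: le; rewrite lt_min => /andP[l1]; rewrite ltr_pdivlMr ?ltr_wpDl// => lC.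
  have := FmBL l k.+1; rewrite Fl sub0r normrN big_ord_recr/= big1 => [|i _]; last first.
    by rewrite IH ?mul0r.
  rewrite add0r !normrM normrX normfV (ger0_norm (ler0n _ _)) => H.
  suff : `|m k| <= C * `|l| by have : 0 <= `|l| by []; nra.
  have lk0 : 0 < `|l| ^+ k / k`!%:R by rewrite divr_gt0 ?exprn_gt0// ltr0n fact_gt0.
  rewrite -(ler_pM2r lk0); apply: (le_trans H).
  apply: (@le_trans _ _ (`|B| * ((`|L| * `|l|) ^+ k.+1 / k.+1`!%:R * expR `|L|))).
    apply: (le_trans (ler_norm _)); rewrite !normrM.
    rewrite ler_wpM2l// ler_pM ?mulr_ge0//.
      by rewrite normrX normrM normr_id normfV !(ger0_norm (ler0n _ _)).
    rewrite ger0_norm ?expR_ge0// ler_expR (le_trans (ler_norm _))//.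
    by rewrite normrM normr_id ler_piMr// ltW.
  have kV : (k.+1`!%:R)^-1 <= (k`!%:R)^-1 :> R.
    by rewrite lef_pV2 ?posrE ?ltr0n ?fact_gt0// ler_nat factS leq_pmull.
  rewrite [leLHS](_ : _ = C * `|l| ^+ k.+1 * (k.+1`!%:R)^-1); last first.
    by rewrite /C exprMn; ring.
  rewrite [leRHS](_ : _ = C * `|l| ^+ k.+1 * (k`!%:R)^-1); last first.
    by rewrite exprS; ring.
  by rewrite ler_wpM2l// mulr_ge0// exprn_ge0.
move=> l; apply/eqP; rewrite -normr_le0; apply/ler_addgt0Pr => e e0; rewrite add0r.
pose C := `|B * expR (L * `|l|)|.
have C0 : 0 <= C by exact: normr_ge0.
have /cvgr_norm_lt : exp_coeff (L * `|l|) n @[n --> \oo] --> 0.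
  exact: cvg_exp_coeff.
move=> /(_ (e / (C + 1))); rewrite normr0 divr_gt0 ?ltr_wpDl// => /(_ isT)[n _ /(_ n)/=].
rewrite leqnn => /(_ isT); rewrite ltr_pdivlMr ?ltr_wpDl// => nC.
have := FmBL l n; rewrite big1 ?subr0 => [H|i _]; last by rewrite m0 mul0r.
apply: (le_trans H); apply: (le_trans (ler_norm _)).
rewrite mulrCA normrM -/C.
have : 0 <= `|(L * `|l|) ^+ n / n`!%:R| by [].
nra.
Qed.

Lemma exp_typeB F G : exp_type F -> exp_type G -> exp_type (fun l => F l - G l).
Proof.
move=> [m [B [L FL]]] [m' [B' [L' GL]]].
pose K := Num.max `|L| `|L'|.
have mono b c l n : `|c| <= K -> b * ((c * `|l|) ^+ n / n`!%:R * expR (c * `|l|)) <=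
    `|b| * ((K * `|l|) ^+ n / n`!%:R * expR (K * `|l|)).
  move=> cK; apply: (le_trans (ler_norm _)); rewrite !normrM ler_wpM2l//.
  rewrite ler_pM//.
    rewrite normfV (ger0_norm (ler0n _ _)) ler_wpM2r// normrX lerXn2r//.
    - by rewrite nnegrE mulr_ge0//; apply: le_trans cK.
    - by rewrite normrM normr_id ler_wpM2r.
  rewrite ger0_norm ?expR_ge0// ler_expR ler_wpM2r//.
  exact: le_trans (ler_norm _) cK.
exists (fun j => m j - m' j), (`|B| + `|B'|), K => l n.
rewrite (_ : _ - _ = (F l - \sum_(j < n) m j * (l ^+ j / j`!%:R)) -
    (G l - \sum_(j < n) m' j * (l ^+ j / j`!%:R))); last first.
  rewrite (eq_bigr (fun j : 'I_n => m j * (l ^+ j / j`!%:R) -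
    m' j * (l ^+ j / j`!%:R))) => [|j _]; last by rewrite mulrBl.
  by rewrite sumrB; ring.
rewrite mulrDl; apply: (le_trans (ler_normB _ _)); apply: lerD.
  by apply: (le_trans (FL l n)); apply: mono; rewrite le_max lexx.
by apply: (le_trans (GL l n)); apply: mono; rewrite le_max lexx orbT.
Qed.

Lemma expR_taylor1 x : `|expR x - 1 - x| <= `|x| ^+ 2 * expR `|x|.
Proof.
have := expR_taylor x 2; rewrite !big_ord_recl big_ord0 /= expr0 expr1 /bump/=.
rewrite !(fact0, factS) !mul1n addr0 invr1 !mulr1 opprD addrA => /le_trans; apply.
have : 0 <= `|x| ^+ 2 * expR `|x| by rewrite mulr_ge0 ?exprn_ge0 ?expR_ge0.
set u := _ ^+ 2; set v := expR _; lra.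
Qed.

(** The linear terms cancel, and the two third-order remainders carry a factor 1/6 each. A cubic
    error is negligible against the h^2 scale of a second difference. *)
Lemma expR_taylor_even x :
  `|expR x + expR (- x) - 2 - x ^+ 2| <= `|x| ^+ 3 * expR `|x|.
Proof.
have := expR_taylor (- x) 3; have := expR_taylor x 3.
rewrite !big_ord_recl !big_ord0 /= !expr0 !expr1 normrN /bump/=.
rewrite !(fact0, factS) !mul1n !addr0 !invr1 !mulr1 sqrrN.
have : 0 <= `|x| ^+ 3 * expR `|x| by rewrite mulr_ge0 ?exprn_ge0 ?expR_ge0.
rewrite (_ : (3 * (2 * 1))%N = 6%N)// (_ : (2 * 1)%N = 2%N)//.
rewrite (_ : (1 + (1 + 0))%N = 2%N)//.
set u := `|x| ^+ 3; set v := expR `|x|; rewrite !ler_norml => uv0.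
by move=> /andP[H1 H2] /andP[H3 H4]; apply/andP; split; lra.
Qed.

End exponential_type.

(** * Scalar estimates for the maximum principle *)

Lemma norm_onem_div_le {R : realFieldType} (r q h : R) :
  0 < r -> h <= r / 2 -> r - h < q <= r -> 0 < q /\ `|1 - r / q| <= 2 * h / r.
Proof.
move=> r0 hr /andP[qh qr]; have q0 : 0 < q by lra.
split => //; rewrite distrC ger0_norm ?subr_ge0; last first.
  by rewrite ler_pdivlMr// mul1r.
rewrite lerBlDr ler_pdivrMr// -(ler_pM2r r0).
rewrite (_ : (2 * h / r + 1) * q * r = (2 * h + r) * q).
  have h0 : 0 <= h by lra.
  have : 0 <= (2 * h + r) * (q - (r - h)) by rewrite mulr_ge0//; lra.
  have : 0 <= h * (r - 2 * h) by rewrite mulr_ge0//; lra.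
  lra.
by field; rewrite gt_eqF.
Qed.


Lemma ler_dist2 {R : realFieldType} (a b c t : R) :
  `|a - c| <= t -> `|b - c| <= t -> a - b <= 2 * t.
Proof. by rewrite !ler_norml => /andP[? ?] /andP[? ?]; lra. Qed.

Lemma second_diff_near_sup {R : realFieldType} (a b p m t : R) :
  a <= m -> b <= m -> m - t < p -> a + b - 2 * p <= 2 * t.
Proof. lra. Qed.

(** To be read with [d] = h^3 and [t] = h^2: [u], [v] are sums of second differences of the two
    transforms, [a], [b] their values, primed after the time step. Near-maximality bounds the drop
    of [a - b] by [d], hence [u - v] from below, and the first hypothesis bounds it from above. *)
Lemma heat_balance {R : realFieldType} (n eps t d S u v a b a' b' m q : R) :
  u - v + n * (2 * eps * t) <= n * (2 * d) ->
  `|u + (a' - a)| <= S * d -> `|v + (b' - b)| <= S * d ->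
  a' - b' + q <= m -> m - d < a - b + q ->
  2 * (n * eps * t) < (2 * S + 2 * n + 1) * d.
Proof. by rewrite !ler_norml => + /andP[? ?] /andP[? ?]; lra. Qed.

Lemma second_diff_split {R : comPzRingType} (a b p a' b' p' e q k h : R) :
  a - a' + e * (q + 2 * h * k + h ^+ 2) +
    (b - b' + e * (q + 2 * (- h) * k + (- h) ^+ 2)) - 2 * (p - p' + e * q) =
  (a + b - 2 * p) - (a' + b' - 2 * p') + 2 * e * h ^+ 2.
Proof. by ring. Qed.

(** * The weighted Laplace transform *)

Section weighted_integral.
Context {R : realType} {N : nat}.
Variables (f : 'rV[R]_N -> R) (L : R).
Hypotheses (f_int : (lebesgue_rV N).-integrable setT (EFin \o f))
  (f_ge0 : forall y, 0 <= f y) (L_ge0 : 0 <= L)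
  (f_supp : forall y, f y != 0 -> sqnorm y <= L ^+ 2).
Implicit Types (phi psi : 'rV[R]_N -> R).

Definition wint phi : R := \int[lebesgue_rV N]_y (phi y * f y).

Lemma wint1 : wint (fun=> 1) = \int[lebesgue_rV N]_y f y.
Proof. by apply: eq_Rintegral => y _; exact: mul1r. Qed.

(** Bounds are asked only on the ball carrying [f]. This class contains linear and quadratic
    functions, is closed under the operations below, and makes every integrand integrable against
    [f]. *)
Definition loc_bounded phi := measurable_fun setT phi /\
  exists C, forall y, sqnorm y <= L ^+ 2 -> `|phi y| <= C.

Lemma loc_bounded_cst c : loc_bounded (fun=> c).
Proof. by split => //; exists `|c|. Qed.

Lemma loc_boundedD phi psi : loc_bounded phi -> loc_bounded psi ->
  loc_bounded (fun y => phi y + psi y).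
Proof.
move=> [mphi [C HC]] [mpsi [D HD]]; split; first exact: measurable_funD.
exists (C + D) => y yL.
by rewrite (le_trans (ler_normD _ _))// lerD// ?HC ?HD.
Qed.

Lemma loc_boundedM phi psi : loc_bounded phi -> loc_bounded psi ->
  loc_bounded (fun y => phi y * psi y).
Proof.
move=> [mphi [C HC]] [mpsi [D HD]]; split; first exact: measurable_funM.
by exists (C * D) => y yL; rewrite normrM ler_pM// ?HC ?HD.
Qed.

Lemma loc_boundedZ c phi : loc_bounded phi -> loc_bounded (fun y => c * phi y).
Proof. by move=> ?; apply: loc_boundedM => //; exact: loc_bounded_cst. Qed.

Lemma loc_boundedB phi psi : loc_bounded phi -> loc_bounded psi ->
  loc_bounded (fun y => phi y - psi y).
Proof.
move=> bphi /(loc_boundedZ (-1)) bpsi.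
rewrite (_ : (fun _ => _) = (fun y => phi y + -1 * psi y)); last first.
  by apply/funext => y; rewrite mulN1r.
exact: loc_boundedD.
Qed.

Lemma loc_boundedX phi n : loc_bounded phi -> loc_bounded (fun y => phi y ^+ n).
Proof.
move=> [mphi [C HC]]; split; first exact: measurable_funX.
exists (C ^+ n) => y yL; rewrite normrX lerXn2r ?nnegrE ?HC//.
by apply: le_trans (HC _ yL).
Qed.

Lemma loc_bounded_sum n (h : 'I_n -> 'rV[R]_N -> R) :
  (forall i, loc_bounded (h i)) -> loc_bounded (fun y => \sum_i h i y).
Proof.
move=> bh; elim: n => [|n IH] in h bh *.
  rewrite (_ : (fun _ => _) = fun=> 0); first exact: loc_bounded_cst.
  by apply/funext => y; rewrite big_ord0.
rewrite (_ : (fun _ => _) =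
  (fun y => h ord0 y + \sum_i h (lift ord0 i) y)); last first.
  by apply/funext => y; rewrite big_ord_recl.
by apply: loc_boundedD => //; exact: IH.
Qed.

Lemma loc_bounded_expR phi : loc_bounded phi ->
  loc_bounded (fun y => expR (phi y)).
Proof.
move=> [mphi [C HC]]; split; first exact: measurableT_comp.
exists (expR C) => y yL; rewrite ger0_norm ?expR_ge0// ler_expR.
exact: le_trans (ler_norm _) (HC _ yL).
Qed.

(** Termwise |ab| <= a^2 + b^2; this replaces Cauchy-Schwarz and avoids square roots. *)
Lemma dotrV_amgm (x y : 'rV[R]_N) : `|dotrV x y| <= sqnorm x + sqnorm y.
Proof.
rewrite (le_trans (ler_norm_sum _ _ _))// -big_split/=; apply: ler_sum => i _.
rewrite normrM -!expr2 -(real_normK (num_real (x _ _))).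
rewrite -(real_normK (num_real (y _ _))).
set a := `|_|; set b := `|_|; have a0 : 0 <= a by exact: normr_ge0.
have b0 : 0 <= b by exact: normr_ge0.
nra.
Qed.

Lemma loc_bounded_dotrV z : loc_bounded (dotrV z).
Proof.
split; first exact: measurable_dotrV.
exists (sqnorm z + L ^+ 2) => y yL.
by rewrite (le_trans (dotrV_amgm _ _))// lerD2l.
Qed.

Lemma loc_bounded_sqnorm : loc_bounded (@sqnorm R N).
Proof.
split; first exact: measurable_sqnorm.
by exists (L ^+ 2) => y yL; rewrite ger0_norm// sqnorm_ge0.
Qed.

Lemma wint_integrable phi : loc_bounded phi ->
  (lebesgue_rV N).-integrable setT (EFin \o (fun y => phi y * f y)).
Proof.
move=> [mphi [C HC]].
have /measurable_int/measurable_EFinP mf := f_int.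
apply: (@le_integrable _ _ _ _ _ measurableT _ (fun y => (C%:E * (f y)%:E)%E)).
- by apply/measurable_EFinP; exact: measurable_funM.
- move=> y _ /=; rewrite lee_fin !normrM.
  have [->|/f_supp yL] := eqVneq (f y) 0; first by rewrite normr0 !mulr0.
  by rewrite ler_wpM2r// (le_trans (HC _ yL))// ler_norm.
- exact: integrableZl.
Qed.

Lemma wintD phi psi : loc_bounded phi -> loc_bounded psi ->
  wint (fun y => phi y + psi y) = wint phi + wint psi.
Proof.
move=> bphi bpsi; rewrite -RintegralD//; try exact: wint_integrable.
by apply: eq_Rintegral => y _; rewrite mulrDl.
Qed.

Lemma wintB phi psi : loc_bounded phi -> loc_bounded psi ->
  wint (fun y => phi y - psi y) = wint phi - wint psi.
Proof.
move=> bphi bpsi; rewrite -RintegralB//; try exact: wint_integrable.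
by apply: eq_Rintegral => y _; rewrite mulrBl.
Qed.

Lemma wintZ c phi : loc_bounded phi -> wint (fun y => c * phi y) = c * wint phi.
Proof.
move=> bphi; rewrite -RintegralZl//; last exact: wint_integrable.
by apply: eq_Rintegral => y _; rewrite mulrA.
Qed.

Lemma wint_sum n (h : 'I_n -> 'rV[R]_N -> R) :
  (forall i, loc_bounded (h i)) ->
  wint (fun y => \sum_i h i y) = \sum_i wint (h i).
Proof.
move=> bh; elim: n => [|n IH] in h bh *.
  rewrite big_ord0 (_ : (fun _ => _) = fun=> 0 * 0).
    by rewrite wintZ ?mul0r//; exact: loc_bounded_cst.
  by apply/funext => y; rewrite big_ord0 mul0r.
rewrite (_ : (fun _ => _) =
  (fun y => h ord0 y + \sum_i h (lift ord0 i) y)); last first.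
  by apply/funext => y; rewrite big_ord_recl.
by rewrite wintD ?IH ?big_ord_recl//; exact: loc_bounded_sum.
Qed.

Lemma wint_ge0 phi : (forall y, 0 <= phi y) -> 0 <= wint phi.
Proof. by move=> phi0; apply: Rintegral_ge0 => y _; rewrite mulr_ge0. Qed.

Lemma wint_le phi psi : loc_bounded phi -> loc_bounded psi ->
  (forall y, sqnorm y <= L ^+ 2 -> phi y <= psi y) -> wint phi <= wint psi.
Proof.
move=> bphi bpsi H; apply: le_Rintegral => //; try exact: wint_integrable.
move=> y _; have [->|/f_supp yL] := eqVneq (f y) 0; first by rewrite !mulr0.
by rewrite ler_wpM2r// H.
Qed.

Lemma wint_norm_le phi C : loc_bounded phi ->
  (forall y, sqnorm y <= L ^+ 2 -> `|phi y| <= C) ->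
  `|wint phi| <= C * wint (fun=> 1).
Proof.
move=> bphi H; have b1 := loc_bounded_cst 1.
rewrite ler_norml -mulNr -!wintZ//; apply/andP; split;
  (apply: wint_le => //; first exact: loc_boundedZ) => y /H;
  by rewrite mulr1 ler_norml => /andP[].
Qed.

(** The Taylor expansion of exp (l b) is integrated term by term: the coefficients are the moments
    of c b^j, and the type is a bound for [b] on the ball carrying [f]. *)
Lemma exp_type_wint (c b : 'rV[R]_N -> R) : loc_bounded c -> loc_bounded b ->
  exp_type (fun l => wint (fun y => c y * expR (l * b y))).
Proof.
move=> bc bb; have [_ [C HC]] := bc; have [_ [K HK]] := bb.
exists (fun j => wint (fun y => c y * b y ^+ j)), (C * wint (fun=> 1)), K => l n.
have bcX j : loc_bounded (fun y => c y * b y ^+ j).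
  by apply: loc_boundedM => //; exact: loc_boundedX.
have bt j : loc_bounded (fun y => l ^+ j / j`!%:R * (c y * b y ^+ j)).
  exact: loc_boundedZ.
rewrite (eq_bigr (fun j : 'I_n =>
    wint (fun y => l ^+ j / j`!%:R * (c y * b y ^+ j)))) => [|j _]; last first.
  by rewrite mulrC wintZ.
rewrite -wint_sum// -wintB; last exact: loc_bounded_sum; last first.
  by apply: loc_boundedM => //; apply: loc_bounded_expR; exact: loc_boundedZ.
rewrite mulrAC; apply: wint_norm_le => [|y yL].
  apply: loc_boundedB; last exact: loc_bounded_sum.
  by apply: loc_boundedM => //; apply: loc_bounded_expR; exact: loc_boundedZ.
rewrite (_ : _ - _ = c y *
    (expR (l * b y) - \sum_(j < n) (l * b y) ^+ j / j`!%:R)); last first.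
  rewrite mulrBr mulr_sumr; congr (_ - _); apply: eq_bigr => j _.
  by rewrite exprMn; ring.
rewrite normrM ler_pM//; first exact: HC.
have lbK : `|l * b y| <= K * `|l| by rewrite normrM mulrC ler_wpM2r// HK.
apply: (le_trans (expR_taylor _ _)); rewrite ler_pM//.
- by rewrite ler_wpM2r// lerXn2r ?nnegrE//; exact: le_trans lbK.
- by rewrite ler_expR.
Qed.

(** * The Laplace transform and the backward heat flow *)

Implicit Types (x y z : 'rV[R]_N).

Let mass := wint (fun=> 1).

Let mass_ge0 : 0 <= mass.
Proof. exact: wint_ge0. Qed.

Definition laplace (z : 'rV[R]_N) (s : R) :=
  wint (fun y => expR (dotrV z y - s * sqnorm y)).

Lemma loc_bounded_kernel z s :
  loc_bounded (fun y : 'rV[R]_N => expR (dotrV z y - s * sqnorm y)).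
Proof.
apply: loc_bounded_expR; apply: loc_boundedB; first exact: loc_bounded_dotrV.
by apply: loc_boundedZ; exact: loc_bounded_sqnorm.
Qed.
Hint Resolve loc_bounded_kernel : core.

Lemma kernel_le z s y (K : R) : sqnorm z <= K -> 0 <= s -> sqnorm y <= L ^+ 2 ->
  expR (dotrV z y - s * sqnorm y) <= expR (K + L ^+ 2).
Proof.
move=> zK s0 yL; rewrite ler_expR.
have := le_trans (ler_norm _) (dotrV_amgm z y).
have := mulr_ge0 s0 (sqnorm_ge0 y).
lra.
Qed.

Lemma laplace_le z s (K : R) : sqnorm z <= K -> 0 <= s ->
  `|laplace z s| <= expR (K + L ^+ 2) * mass.
Proof.
move=> zK s0; apply: wint_norm_le => // y yL.
by rewrite ger0_norm ?expR_ge0// kernel_le.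
Qed.

(** The factor exp (- s |y|^2) is at most 1, so the bound is uniform in [s >= 0]. It serves to
    compare a point near the sphere with its radial projection. *)
Lemma laplaceZ_lip z s (c K : R) : sqnorm z <= K -> sqnorm (c *: z) <= K -> 0 <= s ->
  `|laplace z s - laplace (c *: z) s| <=
  `|1 - c| * ((K + L ^+ 2) * expR (K + L ^+ 2) * mass).
Proof.
move=> zK czK s0; rewrite -wintB// mulrA.
apply: wint_norm_le => [|y yL]; first exact: loc_boundedB.
rewrite !expRD -mulrBl normrM.
have e1 : `|expR (- (s * sqnorm y))| <= 1.
  by rewrite ger0_norm ?expR_ge0// expR_le1 oppr_le0 mulr_ge0// sqnorm_ge0.
apply: (@le_trans _ _ (`|expR (dotrV z y) - expR (dotrV (c *: z) y)| * 1)).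
  by rewrite ler_wpM2l.
have zyK := le_trans (dotrV_amgm z y) (lerD zK yL).
rewrite mulr1; apply: (le_trans (expR_lip zyK _)).
  exact: (le_trans (dotrV_amgm _ y) (lerD czK yL)).
rewrite -expRD dotrVZl mulrA ler_wpM2r ?expR_ge0//.
by rewrite -{1}[dotrV z y]mul1r -mulrBl normrM ler_wpM2l.
Qed.

(** The first summand collects the [N] remainders of the spatial second differences, the other one
    the remainder of the time difference. *)
Let diff_const := N%:R * (L ^+ 3 * expR L) + L ^+ 4 * expR (L ^+ 2).

(* [expR (z.y - s|y|^2)] is annihilated by [d/ds + Laplacian]; this is the
   corresponding finite difference, divided by the exponential. *)
Lemma heat_symbol_le h y : 0 <= h <= 1 -> sqnorm y <= L ^+ 2 ->
  `|\sum_(i < N) (expR (h * y ord0 i) + expR (- (h * y ord0 i)) - 2) +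
    (expR (- (h ^+ 2 * sqnorm y)) - 1)| <= diff_const * h ^+ 3.
Proof.
move=> /andP[h0 h1] yL.
rewrite [X in `|X|](_ : _ =
    \sum_(i < N) (expR (h * y ord0 i) + expR (- (h * y ord0 i)) - 2
      - (h * y ord0 i) ^+ 2) +
    (expR (- (h ^+ 2 * sqnorm y)) - 1 + h ^+ 2 * sqnorm y)); last first.
  rewrite [X in _ = X + _]sumrB (_ : \sum_(i < N) (h * y ord0 i) ^+ 2 = h ^+ 2 * sqnorm y).
    by ring.
  by rewrite mulr_sumr; apply: eq_bigr => i _; rewrite exprMn expr2.
rewrite mulrDl; apply: (le_trans (ler_normD _ _)); apply: lerD.
  apply: (le_trans (ler_norm_sum _ _ _)).
  apply: (@le_trans _ _ (\sum_(i < N) L ^+ 3 * expR L * h ^+ 3)); last first.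
    by rewrite sumr_const card_ord -[leLHS]mulr_natl; lra.
  apply: ler_sum => i _.
  set a := h * _; have aL : `|a| <= h * L.
    rewrite normrM ger0_norm// ler_wpM2l//.
    rewrite -(ler_pXn2r (n := 2))// ?nnegrE// real_normK ?num_real//.
    exact: le_trans (sqr_coord_le _ _) yL.
  apply: (le_trans (expR_taylor_even a)).
  apply: (@le_trans _ _ ((h * L) ^+ 3 * expR L)); last by rewrite exprMn; lra.
  rewrite ler_pM ?exprn_ge0 ?expR_ge0//.
    by rewrite lerXn2r ?nnegrE ?mulr_ge0.
  by rewrite ler_expR (le_trans aL)// ler_piMl.
have q0 := sqnorm_ge0 y; set q := sqnorm y in yL q0 *.
have hq : h ^+ 2 * q <= h ^+ 2 * L ^+ 2 by rewrite ler_wpM2l ?sqr_ge0.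
have hq0 : 0 <= h ^+ 2 * q by rewrite mulr_ge0 ?sqr_ge0.
have := expR_taylor1 (- (h ^+ 2 * q)); rewrite opprK normrN (ger0_norm hq0).
move=> /le_trans; apply.
apply: (@le_trans _ _ ((h ^+ 2 * L ^+ 2) ^+ 2 * expR (L ^+ 2))).
  rewrite ler_pM ?exprn_ge0 ?expR_ge0//.
    by rewrite lerXn2r ?nnegrE ?mulr_ge0 ?sqr_ge0.
  by rewrite ler_expR (le_trans hq)// ler_piMl ?sqr_ge0// expr_le1.
rewrite [leLHS](_ : _ = L ^+ 4 * expR (L ^+ 2) * h ^+ 3 * h); last by ring.
by rewrite ler_piMr// !mulr_ge0 ?exprn_ge0 ?expR_ge0.
Qed.

Let step_const (K : R) := expR (K + L ^+ 2) * diff_const * mass.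

(** Shifting [z] by [x] multiplies the rotated kernel by exp (x . yA), and |yA| = |y|, so the whole
    expression is the kernel times the symbol of [heat_symbol_le] taken at [y *m A]. A time step h^2
    matches space steps h. *)
Lemma laplace_heat_step (A : 'M[R]_N) z s h K : A^T *m A = 1%:M ->
  0 <= h <= 1 -> 0 <= s -> sqnorm z <= K ->
  `|\sum_(i < N) (laplace ((z + h *: delta_mx ord0 i) *m A^T) s +
                  laplace ((z + (- h) *: delta_mx ord0 i) *m A^T) s -
                  2 * laplace (z *m A^T) s) +
    (laplace (z *m A^T) (s + h ^+ 2) - laplace (z *m A^T) s)| <=
  step_const K * h ^+ 3.
Proof.
move=> AA h01 s0 zK; have AA' := mulmx1C AA.
pose k y := expR (dotrV (z *m A^T) y - s * sqnorm y).
have bk : loc_bounded k by exact: loc_bounded_kernel.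
have kS x y : expR (dotrV ((z + x) *m A^T) y - s * sqnorm y) =
    k y * expR (dotrV x (y *m A)).
  by rewrite -expRD mulmxDl dotrVDl (dotrV_mulmx_tr _ x); congr expR; ring.
rewrite [X in `|X|](_ : _ = wint (fun y => k y *
  (\sum_(i < N) (expR (h * (y *m A) ord0 i) + expR (- (h * (y *m A) ord0 i)) - 2)
   + (expR (- (h ^+ 2 * sqnorm (y *m A))) - 1)))); last first.
  rewrite [RHS](_ : _ = wint (fun y =>
    \sum_(i < N)
       (expR (dotrV ((z + h *: delta_mx ord0 i) *m A^T) y - s * sqnorm y) +
        expR (dotrV ((z + (- h) *: delta_mx ord0 i) *m A^T) y - s * sqnorm y) -
        2 * k y) +
    (expR (dotrV (z *m A^T) y - (s + h ^+ 2) * sqnorm y) - k y))); last first.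
    congr wint; apply/funext => y; rewrite mulrDr mulr_sumr; congr (_ + _).
      apply: eq_bigr => i _; rewrite !kS !dotrVZl dotrV_delta.
      by rewrite mulNr; ring.
    rewrite mulrBr mulr1 -expRD sqnorm_mulmx_orth//; congr (expR _ - _).
    by ring.
  have bsum i : loc_bounded (fun y =>
      expR (dotrV ((z + h *: delta_mx ord0 i) *m A^T) y - s * sqnorm y) +
      expR (dotrV ((z + (- h) *: delta_mx ord0 i) *m A^T) y - s * sqnorm y) -
      2 * k y).
    by apply: loc_boundedB; [exact: loc_boundedD|exact: loc_boundedZ].
  rewrite wintD; [|exact: loc_bounded_sum|exact: loc_boundedB].
  rewrite wint_sum// [X in _ = _ + X]wintB//; congr (_ + _).
  apply: eq_bigr => i _.
  by rewrite wintB ?wintD ?wintZ//; [exact: loc_boundedD|exact: loc_boundedZ].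
rewrite (_ : step_const K * h ^+ 3 =
    expR (K + L ^+ 2) * (diff_const * h ^+ 3) * mass); last first.
  by rewrite /step_const; ring.
have bcoord (c : R) i : loc_bounded (fun y => expR (c * (y *m A) ord0 i)).
  apply: loc_bounded_expR; apply: loc_boundedZ.
  rewrite (_ : (fun _ => _) = dotrV (delta_mx ord0 i *m A^T)).
    exact: loc_bounded_dotrV.
  by apply/funext => y; rewrite dotrV_mulmx_tr dotrV_delta.
have b1 := loc_bounded_cst; apply: wint_norm_le => [|y yL].
  apply: loc_boundedM => //; apply: loc_boundedD.
    apply: loc_bounded_sum => i; apply: loc_boundedB => //; apply: loc_boundedD => //.
    by under eq_fun do rewrite -mulNr; exact: bcoord.
  apply: loc_boundedB => //; apply: loc_bounded_expR.
  under eq_fun do rewrite sqnorm_mulmx_orth// -mulNr.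
  by apply: loc_boundedZ; exact: loc_bounded_sqnorm.
have yAL : sqnorm (y *m A) <= L ^+ 2 by rewrite sqnorm_mulmx_orth.
rewrite normrM ler_pM//; last exact: heat_symbol_le.
rewrite ger0_norm ?expR_ge0// kernel_le// sqnorm_mulmx_orth//.
by rewrite trmxK.
Qed.

(* Maximum principle for the backward heat flow [laplace _ s], [s >= 0], on a
   ball: at a near maximum of [W + eps |z|^2] the finite differences of
   [laplace_heat_step] are almost nonpositive, whereas [eps |z|^2] contributes
   [2 N eps h^2]. *)
Lemma laplace_rot_le (A : 'M[R]_N) (r : R) : (0 < N)%N -> A^T *m A = 1%:M -> 0 < r ->
  (forall z s, 0 <= s -> sqnorm z = r ^+ 2 -> laplace z s = laplace (z *m A^T) s) ->
  forall z s, 0 <= s -> sqnorm z <= r ^+ 2 -> laplace z s <= laplace (z *m A^T) s.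
Proof.
move=> N0 AA r0 bd z1 s1 s10 z1r.
have sqA z : sqnorm (z *m A^T) = sqnorm z by rewrite sqnorm_mulmx_orth ?trmxK.
pose W z s := laplace z s - laplace (z *m A^T) s.
rewrite leNgt; apply/negP => W1.
(* [w] is half of the supposed positive excess, and [eps] is chosen so that [eps * sqnorm z] is at
   most [w] on the ball. *)
pose w := W z1 s1 / 2; have w0 : 0 < w by rewrite divr_gt0// subr_gt0.
pose eps := w / r ^+ 2; have eps0 : 0 < eps by rewrite divr_gt0// exprn_gt0.
have epsr : eps * r ^+ 2 = w by rewrite divfK// expf_neq0// gt_eqF.
pose P z s := W z s + eps * sqnorm z.
have r2r : r / 2 <= r by rewrite ler_pdivrMr// ler_peMr ?ler1n// ltW.
pose K := r ^+ 2.
pose M := expR (K + L ^+ 2) * mass.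
have M0 : 0 <= M by rewrite mulr_ge0// expR_ge0.
(* Time runs over the whole half-line, so a step to [s + h ^+ 2] stays admissible; the supremum may
   not be attained, whence a near maximum is used. *)
pose Q := [set p | exists z s, [/\ 0 <= s, sqnorm z <= r ^+ 2 & p = P z s]].
have supQ : has_sup Q.
  split; first by exists (P z1 s1), z1, s1.
  exists (M + M + w) => _ [z [s [s0 zr ->]]]; rewrite lerD//; last first.
    by rewrite -epsr ler_wpM2l// ltW.
  apply: (le_trans (ler_norm _)); apply: (le_trans (ler_normB _ _)).
  by rewrite lerD// laplace_le// sqA.
have P_le z s : 0 <= s -> sqnorm z <= r ^+ 2 -> P z s <= sup Q.
  by move=> s0 zr; apply: ub_le_sup; [case: supQ|exists z, s].
have supQ_ge : 2 * w <= sup Q.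
  apply: le_trans (P_le _ _ s10 z1r); rewrite /P mulrC divfK// lerDl.
  by rewrite mulr_ge0 ?sqnorm_ge0// ltW.
(* The factor 4 / r is 2 / r from the radial projection, doubled because two transforms are
   compared. *)
pose C1 := 4 / r * ((K + L ^+ 2) * expR (K + L ^+ 2) * mass).
have C10 : 0 <= C1.
  by rewrite !mulr_ge0 ?expR_ge0 ?invr_ge0 ?addr_ge0 ?sqr_ge0// ltW.
have C1p : 0 < C1 + 1 by rewrite ltr_wpDl.
have near_bd h z s : 0 < h <= r / 2 -> 0 <= s -> sqnorm z <= r ^+ 2 ->
    (r - h) ^+ 2 < sqnorm z -> W z s <= C1 * h.
  move=> /andP[h0 hr] s0 zr zh.
  pose q := Num.sqrt (sqnorm z).
  have qE : q ^+ 2 = sqnorm z by rewrite sqr_sqrtr// sqnorm_ge0.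
  have q0 : 0 <= q by exact: sqrtr_ge0.
  have qr : q <= r by rewrite -(ler_pXn2r (n := 2))// ?nnegrE ?qE// ltW.
  have qh : r - h < q.
    rewrite -(ltr_pXn2r (n := 2))// ?nnegrE ?qE// subr_ge0 (le_trans hr r2r)//.
  (* Scaling by [r / q] projects [z] onto the sphere, where the two transforms agree; as
     [h <= r / 2], the scaling factor is within 2h / r of 1. *)
  have [|qp c1] := norm_onem_div_le r0 hr (q := q); first by rewrite qh.
  pose c := r / q.
  have czr : sqnorm (c *: z) = r ^+ 2.
    by rewrite sqnormZ -qE -exprMn divfK// gt_eqF.
  have cA : (c *: z) *m A^T = c *: (z *m A^T) by rewrite -scalemxAl.
  have := bd _ _ s0 czr; rewrite cA => bdc.
  have czK : sqnorm (c *: z) <= r ^+ 2 by rewrite czr.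
  have l1 := laplaceZ_lip zr czK s0.
  rewrite -(sqA z) in zr; rewrite -(sqA (c *: z)) cA in czK.
  have l2 := laplaceZ_lip zr czK s0.
  rewrite -/K in l1 l2; set T := _ * mass in l1 l2.
  have T0 : 0 <= T.
    by rewrite !mulr_ge0 ?expR_ge0 ?addr_ge0 ?sqr_ge0.
  rewrite -bdc in l2; apply: (le_trans (ler_dist2 l1 l2)).
  rewrite (_ : C1 * h = 2 * (2 * h / r * T)); last by rewrite /C1 /T; ring.
  by have := ler_wpM2r T0 c1; rewrite -(@ler_pM2l _ 2)// ltr0n.
pose S := step_const K.
have S0 : 0 <= S.
  rewrite /S /step_const /diff_const !mulr_ge0 ?expR_ge0// addr_ge0//.
    by rewrite !mulr_ge0 ?exprn_ge0 ?expR_ge0.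
  by rewrite mulr_ge0 ?exprn_ge0 ?expR_ge0.
have NR0 : 0 < N%:R :> R by rewrite ltr0n.
pose D := 2 * S + 2 * N%:R + 1; have D0 : 0 < D.
  by rewrite /D ltr_wpDl// addr_ge0// mulr_ge0.
(* [hr], [hw] and [hC] keep near maxima out of the boundary layer of width [h]; [hD] contradicts
   [heat_balance], whose constant is [D]. *)
have [h [h01 hr hw hC hD]] : exists h, [/\ 0 < h <= 1, h <= r / 2, h <= w / 2,
    C1 * h <= w / 2 & D * h <= N%:R * eps].
  pose h := Num.min (Num.min 1 (r / 2))
    (Num.min (w / 2) (Num.min (w / 2 / (C1 + 1)) (N%:R * eps / D))).
  have : h <= h by [].
  rewrite {2}/h !le_min => /andP[/andP[h1 hr] /andP[hw /andP[hC hD]]].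
  have h0 : 0 < h.
    have w2 : 0 < w / 2 by exact: divr_gt0.
    have wC : 0 < w / 2 / (C1 + 1) by exact: divr_gt0.
    have eD : 0 < N%:R * eps / D by apply: divr_gt0 => //; exact: mulr_gt0.
    by rewrite /h !lt_min ltr01 w2 wC eD divr_gt0.
  exists h; split => //; first by rewrite h0.
    move: hC; rewrite ler_pdivlMr// => /(le_trans _); apply.
    by rewrite mulrC; apply: ler_wpM2l; [exact: ltW|rewrite lerDl].
  by move: hD; rewrite ler_pdivlMr// mulrC.
have /andP[h0 h1] := h01; have h01' : 0 <= h <= 1 by rewrite ltW.
have h3 : 0 < h ^+ 3 by rewrite exprn_gt0.
(* The tolerance h^3 has the order of the error of the scheme and is beaten by the gain of order
   [eps * h ^+ 2]. *)
have [_ [z [s [s0 zr ->]]] Pz] := sup_adherent h3 supQ.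
(* In the boundary layer P is at most w / 2 + w, while a near maximum exceeds 2w - h^3, which is at
   least 2w - w / 2. *)
have zh : sqnorm z <= (r - h) ^+ 2.
  rewrite leNgt; apply/negP => zh; have := near_bd h z s _ s0 zr zh.
  rewrite h0 hr => /(_ isT) Wz.
  have h3w : h ^+ 3 <= w / 2.
    apply: le_trans hw; rewrite exprS.
    by apply: ler_piMr; [|apply: exprn_ile1 => //]; exact: ltW.
  have epsw : eps * sqnorm z <= w by rewrite -epsr ler_wpM2l// ltW.
  have := lt_le_trans Pz (lerD (le_trans Wz hC) epsw).
  rewrite ltrBlDr => /(le_lt_trans supQ_ge).
  move=> /lt_le_trans/(_ (lerD (lexx _) h3w)).
  by rewrite (_ : _ + _ = 2 * w) ?ltxx//; field.
have rh : 0 <= r - h by rewrite subr_ge0 (le_trans hr r2r)//.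
(* A shift by [h] from the ball of radius [r - h] ends in the ball of radius [r], by expanding r^2 =
   ((r - h) + h)^2. *)
have shift_in c i : c = h \/ c = - h ->
    sqnorm (z + c *: delta_mx ord0 i) <= r ^+ 2.
  have : `|z ord0 i| <= r - h.
    rewrite -(ler_pXn2r (n := 2))// ?nnegrE// real_normK ?num_real//.
    exact: le_trans (sqr_coord_le _ _) zh.
  rewrite ler_norml sqnorm_shift => /andP[zi1 zi2] ch.
  have : c * z ord0 i <= h * (r - h) /\ c ^+ 2 = h ^+ 2.
    case: ch => ->; rewrite ?sqrrN; split=> //.
      by rewrite ler_wpM2l// ltW.
    by rewrite mulNr -mulrN; apply: ler_wpM2l; [exact: ltW|rewrite lerNl].
  move=> [czi ->]; rewrite (_ : r ^+ 2 = (r - h) ^+ 2 + 2 * (h * (r - h)) + h ^+ 2).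
    by rewrite lerD2r lerD// -mulrA ler_pM2l.
  by ring.
have stepA := laplace_heat_step AA h01' s0 zr.
(* The identity matrix gives the same estimate for the transform without rotation. *)
have one_orth : (1%:M : 'M[R]_N)^T *m 1%:M = 1%:M by rewrite trmx1 mulmx1.
have := laplace_heat_step one_orth h01' s0 zr.
rewrite -/S in stepA *; rewrite trmx1 mulmx1.
under eq_bigr do rewrite !mulmx1.
move=> step1.
pose V i := laplace (z + h *: delta_mx ord0 i) s +
  laplace (z + (- h) *: delta_mx ord0 i) s - 2 * laplace z s.
pose VA i := laplace ((z + h *: delta_mx ord0 i) *m A^T) s +
  laplace ((z + (- h) *: delta_mx ord0 i) *m A^T) s - 2 * laplace (z *m A^T) s.
have sumP : \sum_(i < N) (P (z + h *: delta_mx ord0 i) s +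
      P (z + (- h) *: delta_mx ord0 i) s - 2 * P z s) =
    \sum_(i < N) V i - \sum_(i < N) VA i + N%:R * (2 * eps * h ^+ 2).
  rewrite (_ : N%:R * _ = \sum_(i < N) (2 * eps * h ^+ 2)).
    rewrite -sumrB -big_split/=; apply: eq_bigr => i _.
    by rewrite /P /W !sqnorm_shift; exact: second_diff_split.
  by rewrite sumr_const card_ord mulr_natl.
have sumP_le : \sum_(i < N) (P (z + h *: delta_mx ord0 i) s +
    P (z + (- h) *: delta_mx ord0 i) s - 2 * P z s) <= N%:R * (2 * h ^+ 3).
  rewrite (_ : N%:R * _ = \sum_(i < N) (2 * h ^+ 3)); last first.
    by rewrite sumr_const card_ord mulr_natl.
  apply: ler_sum => i _.
  apply: second_diff_near_sup Pz; apply: P_le s0 _; apply: shift_in.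
    by left.
  by right.
have sh0 : 0 <= s + h ^+ 2 by rewrite addr_ge0 ?sqr_ge0.
have Dh : 2 * (N%:R * eps * h ^+ 2) < D * h ^+ 3.
  by move: sumP_le; rewrite sumP => /heat_balance; apply;
    [exact: step1|exact: stepA|exact: P_le _ _ sh0 zr|exact: Pz].
(* With X = N eps h^2 > 0 this yields 2X < D h^3 <= X. *)
have : D * h * h ^+ 2 <= N%:R * eps * h ^+ 2 by rewrite ler_wpM2r ?sqr_ge0.
move=> /(lt_le_trans _); rewrite -mulrA -exprS => /(_ _ Dh).
have X0 : 0 < N%:R * eps * h ^+ 2.
  by apply: mulr_gt0; [exact: mulr_gt0|exact: exprn_gt0].
by rewrite gtr_pMl// ltNge ler1n.
Qed.

(** * Analyticity in time and along rays; unique continuation *)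

Lemma exp_type_laplace_time z : exp_type (laplace z).
Proof.
have := exp_type_wint (loc_bounded_expR (loc_bounded_dotrV z))
  (loc_boundedZ (-1) loc_bounded_sqnorm).
congr exp_type; apply/funext => s; congr wint; apply/funext => y.
by rewrite -expRD; congr expR; ring.
Qed.

Lemma exp_type_laplace_ray z s : exp_type (fun l => laplace (l *: z) s).
Proof.
have := exp_type_wint (loc_bounded_expR (loc_boundedZ (- s) loc_bounded_sqnorm))
  (loc_bounded_dotrV z).
congr exp_type; apply/funext => l; congr wint; apply/funext => y.
by rewrite -expRD dotrVZl; congr expR; ring.
Qed.

(** Three extensions in turn: from small times to all times on the sphere by analyticity in [s],
    from the sphere to the ball by the maximum principle, and from the ball to the whole space by
    analyticity along rays. *)
Lemma laplace_rot_invariant (A : 'M[R]_N) (r : R) :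
  (0 < N)%N -> A^T *m A = 1%:M -> 0 < r ->
  (forall e, 0 < e -> exists2 s, 0 < s < e &
    forall z, sqnorm z = r ^+ 2 -> laplace z s = laplace (z *m A^T) s) ->
  forall z s, 0 <= s -> laplace z s = laplace (z *m A^T) s.
Proof.
move=> N0 AA r0 H; have AA' := mulmx1C AA.
have sqA z : sqnorm (z *m A^T) = sqnorm z by rewrite sqnorm_mulmx_orth ?trmxK.
have sphere z s : sqnorm z = r ^+ 2 -> laplace z s = laplace (z *m A^T) s.
  move=> zr; apply/eqP; rewrite -subr_eq0; apply/eqP; move: s.
  apply: (exp_type_eq0 (exp_typeB (exp_type_laplace_time z)
    (exp_type_laplace_time (z *m A^T)))).
  move=> e e0; have [s' /andP[s'0 s'e] Hs'] := H e e0.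
  by exists s'; [rewrite normr_gt0 gt_eqF//= gtr0_norm|rewrite Hs'// subrr].
have in_ball z s : 0 <= s -> sqnorm z <= r ^+ 2 ->
    laplace z s = laplace (z *m A^T) s.
  move=> s0 zr; apply/eqP; rewrite eq_le; apply/andP; split.
    by apply: (laplace_rot_le N0 AA r0 _ s0 zr) => z' s' _; exact: sphere.
  (* The reverse inequality is the same one for the inverse rotation, taken at the point
     [z *m A^T]. *)
  have AT : A^T^T *m A^T = 1%:M by rewrite trmxK.
  have {2}-> : z = z *m A^T *m A^T^T by rewrite trmxK -mulmxA AA mulmx1.
  have zAr : sqnorm (z *m A^T) <= r ^+ 2 by rewrite sqA.
  apply: (laplace_rot_le N0 AT r0 _ s0 zAr) => z' s' _ z'r; rewrite trmxK [RHS]sphere.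
    by rewrite -mulmxA AA' mulmx1.
  by rewrite sqnorm_mulmx_orth.
move=> z s s0; rewrite -[z]scale1r -scalemxAl; apply/eqP.
rewrite -subr_eq0; apply/eqP; move: (1 : R).
apply: (exp_type_eq0 (exp_typeB (exp_type_laplace_ray z s)
  (exp_type_laplace_ray (z *m A^T) s))).
move=> e e0; have zp : 0 < sqnorm z + 1 by rewrite ltr_wpDl// sqnorm_ge0.
have r2 : 0 < r ^+ 2 by rewrite exprn_gt0.
(* This puts [l *: z] in the ball: since [l <= 1], l^2 |z|^2 <= l (|z|^2 + 1) <= r^2. The summand 1
   covers [z = 0]. *)
pose l := Num.min (Num.min 1 (e / 2)) (r ^+ 2 / (sqnorm z + 1)).
have l0 : 0 < l by rewrite /l !lt_min ltr01 divr_gt0// divr_gt0.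
have : l <= l by []; rewrite {2}/l !le_min => /andP[/andP[l1 le2] lz].
exists l; first by rewrite gtr0_norm// l0 (le_lt_trans le2)// ltr_pdivrMr// ltr_pMr// ltr1n.
rewrite in_ball// -?scalemxAl ?subrr// sqnormZ.
move: lz; rewrite ler_pdivlMr// => /(le_trans _); apply.
rewrite expr2 -mulrA; apply: ler_wpM2l; first exact: ltW.
by have := ler_wpM2r (sqnorm_ge0 z) l1; rewrite mul1r => /le_trans; apply; rewrite lerDl.
Qed.

(** * The heat solution in terms of the transform *)

Lemma heat_solutionE x t : 0 < t ->
  heat_solution f x t = (4 * pi * t) `^ (- (N%:R / 2)) *
    (expR (- (sqnorm x / (4 * t))) * laplace ((2 * t)^-1 *: x) (4 * t)^-1).
Proof.
move=> t0; rewrite /heat_solution; congr (_ * _); rewrite -wintZ//.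
apply: eq_Rintegral => y _; congr (_ * f y); rewrite -expRD; congr expR.
rewrite -(scaleN1r y) sqnormD sqnormZ (dotrVC x) !dotrVZl (dotrVC y).
by field; rewrite gt_eqF.
Qed.

(** At the point [t *: x] the spatial argument of the transform no longer depends on [t], so all
    exponential growth or decay in [t] sits in the explicit factor. *)
Lemma heat_solution_scaled x t : 0 < t ->
  heat_solution f (t *: x) t = (4 * pi * t) `^ (- (N%:R / 2)) *
    (expR (- (t * sqnorm x / 4)) * laplace (2^-1 *: x) (4 * t)^-1).
Proof.
move=> t0; have t_neq0 : t != 0 by rewrite gt_eqF.
rewrite (heat_solutionE (t *: x) t0) sqnormZ scalerA.
congr (_ * (expR (- _) * laplace _ _)).
  by field.
by congr (_ *: _); field.
Qed.

Hypothesis mass_gt0 : 0 < mass.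

Lemma laplace_ge z s : 0 <= s <= 1 ->
  expR (- (sqnorm z + 2 * L ^+ 2)) * mass <= laplace z s.
Proof.
move=> /andP[s0 s1]; have b1 := loc_bounded_cst 1.
rewrite -wintZ//; apply: wint_le => //; first exact: loc_boundedZ.
move=> y yL; rewrite mulr1 ler_expR.
have := le_trans (ler_norm _) (dotrV_amgm z y).
have := dotrV_amgm z y; rewrite ler_norml => /andP[+ _] _.
have := ler_wpM2r (sqnorm_ge0 y) s1.
lra.
Qed.

(* The ratio of the values at [t x'] and [t x] is [exp (t (|x|^2 - |x'|^2) / 4)]
   times a quantity bounded above and below uniformly in [t >= 1]. *)
Lemma level_sqnorm_le (t : nat -> R) x x' : (forall n, 0 < t n) ->
  t @ \oo --> +oo ->
  (forall n, heat_solution f (t n *: x) (t n) = heat_solution f (t n *: x') (t n)) ->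
  sqnorm x <= sqnorm x'.
Proof.
move=> t0 toy H; rewrite leNgt; apply/negP => xx'.
pose d := (sqnorm x - sqnorm x') / 4.
have d0 : 0 < d by rewrite divr_gt0// subr_gt0.
pose z := 2^-1 *: x; pose z' := 2^-1 *: x'.
pose m := expR (- (sqnorm z' + 2 * L ^+ 2)) * mass.
pose M := expR (sqnorm z + L ^+ 2) * mass.
have m0 : 0 < m by rewrite mulr_gt0// expR_gt0.
(* For such a time the growth factor exp (t d) >= 1 + t d pushes the lower bound [m] past the upper
   bound [M]; [t n > 1] ensures [s <= 1]. *)
have /cvgryPgt/(_ (Num.max 1 (M / (m * d)))) [n _ /(_ n (leqnn n))] := toy.
have md : 0 < m * d by exact: mulr_gt0.
rewrite gt_max ltr_pdivrMr// => /andP[t1 tM].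
have tn0 := t0 n; have tn_neq0 : t n != 0 by rewrite gt_eqF.
pose s := (4 * t n)^-1.
have s01 : 0 <= s <= 1.
  have t4 : 0 < 4 * t n by rewrite mulr_gt0.
  rewrite invr_ge0 (ltW t4) invf_le1// (le_trans (ltW t1))//.
  by rewrite ler_peMl ?ler1n// ltW.
have c0 : (4 * pi * t n) `^ (- (N%:R / 2)) != 0.
  by rewrite gt_eqF// powR_gt0// !mulr_gt0// pi_gt0.
have := H n; rewrite (heat_solution_scaled x tn0) (heat_solution_scaled x' tn0).
move=> /(mulfI c0) Hn.
have {}Hn : laplace z s = expR (t n * d) * laplace z' s.
  rewrite (_ : t n * d = t n * sqnorm x / 4 - t n * sqnorm x' / 4); last first.
    by rewrite /d; ring.
  rewrite expRD -mulrA -Hn mulrA -expRD addrN expR0 mul1r//.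
have mz' : m <= laplace z' s by exact: laplace_ge.
have Mz : laplace z s <= M.
  apply: (le_trans (ler_norm _)); apply: laplace_le => //.
  by case/andP: s01.
have : (1 + t n * d) * m <= M.
  apply: le_trans Mz; rewrite Hn ler_pM ?expR_ge1Dx//; last exact: ltW.
  by rewrite addr_ge0// mulr_ge0// ltW.
apply/negP; rewrite -ltNge (lt_trans tM)//.
by rewrite mulrDl mul1r (mulrC m) mulrA ltrDr.
Qed.

End weighted_integral.

(* Otherwise unification unfolds these down to the integral. *)
#[local] Opaque wint laplace.

(** * Radial symmetry *)

(** The point is [sup S *: v], with [S] the set of parameters at which the ray's line is in [D].
    Boundedness makes the supremum finite, and openness keeps it out of [S] and makes it
    positive. *)
Lemma ray_meets_boundary {R : realType} {N : nat} (D : set 'rV[R]_N) v :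
  open D -> bounded_set D -> D 0 -> v != 0 ->
  exists2 l : R, 0 < l & boundary D (l *: v).
Proof.
move=> oD [M0 [_ DM]] D0 v0.
pose M := Num.max 1 (M0 + 1).
have {}DM y : D y -> `|y| <= M by apply: DM; rewrite lt_max ltrDl ltr01 orbT.
pose S := [set l : R | D (l *: v)].
have nv : 0 < `|v| by rewrite normr_gt0.
have cv : continuous (fun l : R => l *: v) by move=> l; exact: scalel_continuous.
have oS : open S by exact: open_comp (fun l _ => cv l) oD.
have supS : has_sup S.
  split; first by exists 0; rewrite /S/= scale0r.
  exists (M / `|v|) => l /DM; rewrite normrZ ler_pdivlMr//.
  by apply: le_trans; rewrite ler_wpM2r// ler_norm.
have lt_sup l : S l -> l < sup S.
  move=> Sl; have /nbhs_ballP[e /= e0 leS] := open_nbhs_nbhs (conj oS Sl).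
  apply: (@lt_le_trans _ _ (l + e / 2)); first by rewrite ltrDl divr_gt0.
  apply: ub_le_sup; first by case: supS.
  apply: leS; rewrite /ball/= opprD addrA subrr sub0r normrN gtr0_norm ?divr_gt0//.
  by rewrite ltr_pdivrMr// ltr_pMr// ltr1n.
exists (sup S); first by apply: lt_sup; rewrite /S/= scale0r.
split; last by move=> /interior_subset /lt_sup; rewrite ltxx.
move=> B /cv /nbhs_ballP[e /= e0 eB].
have [l Sl le] := sup_adherent e0 supS.
exists (l *: v); split => //; apply: eB; rewrite /ball/= gtr0_norm ?subr_gt0 ?lt_sup//.
by rewrite ltrBlDr -ltrBlDl.
Qed.

Theorem theorem1p1 (R : realType) (N : nat) (N_ge1 : (1 <= N)%N)
    (g : 'rV[R]_N -> R)
    (g_measurable : lebesgue_measurable_fun g)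
    (g_ge0 : forall x, 0 <= g x)
    (g_bounded : exists M : R, forall x, g x <= M)
    (g_nontrivial : ~ {ae lebesgue_rV N, forall x, g x = 0})
    (g_support : compact (ess_support g))
    (level : exists Omega : set 'rV[R]_N,
      [/\ domain Omega, bounded_set Omega, C1_boundary Omega,
          ess_support g `|` [set 0] `<=` Omega &
          exists t a : nat -> R,
            [/\ forall n, 0 < t n, forall n, 0 < a n,
                nondecreasing_seq t, t @ \oo --> +oo &
                forall n x, boundary Omega x ->
                  heat_solution g (t n *: x) (t n) = a n]]) :
  radially_symmetric (heat_solution g).
Proof.
have [f [L [[f_int f_ge0 L_ge0 f_supp f_gt0] fg]]] :=
  exists_borel_datum g_measurable g_ge0 g_bounded g_nontrivial g_support.
have gf x t : heat_solution g x t = heat_solution f x t.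
  by rewrite /heat_solution fg// => y; exact: expR_ge0.
have mass_gt0 : 0 < wint f (fun=> 1).
  by rewrite wint1.
case: level => Om [[oOm _] bOm _ gOm [t [a [t0 _ _ toy lvl]]]].
have {}lvl n x : boundary Om x -> heat_solution f (t n *: x) (t n) = a n.
  by rewrite -gf; exact: lvl.
have Om0 : Om 0 by apply: gOm; right.
have bd_le x x' : boundary Om x -> boundary Om x' -> sqnorm x <= sqnorm x'.
  move=> bx bx'; apply: (level_sqnorm_le f_int f_ge0 f_supp mass_gt0 t0 toy).
  by move=> n; rewrite !lvl.
have bd_eq x x' : boundary Om x -> boundary Om x' -> sqnorm x = sqnorm x'.
  by move=> bx bx'; apply/eqP; rewrite eq_le !bd_le.
(* A unit vector, so the parameter at which its ray meets the boundary is the radius of the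
   sphere. *)
pose v : 'rV[R]_N := delta_mx ord0 (Ordinal N_ge1).
have neq0 (x : 'rV[R]_N) : 0 < sqnorm x -> x != 0.
  by apply: contraTneq => ->; rewrite /sqnorm dotrVE mul0mx mxE ltxx.
have v1 : sqnorm v = 1 by exact: sqnorm_delta.
have v_neq0 : v != 0 by rewrite neq0// v1.
have [rho rho0 bdv] := ray_meets_boundary oOm bOm Om0 v_neq0.
(* The ray through [x] meets the boundary at some [l *: x], whose length must also be [rho]; hence
   [l = 1]. *)
have sphere x : sqnorm x = rho ^+ 2 -> boundary Om x.
  move=> xr; have x0 : x != 0 by rewrite neq0// xr exprn_gt0.
  have [l l0 bdx] := ray_meets_boundary oOm bOm Om0 x0.
  move: (bdx); rewrite (_ : l = 1) ?scale1r//.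
  have := bd_eq _ _ bdx bdv; rewrite !sqnormZ xr v1 mulr1 -[RHS]mul1r.
  move=> /mulIf; rewrite expf_eq0/= gt_eqF// => /(_ isT)/eqP.
  by rewrite sqrf_eq1 => /orP[/eqP//|/eqP l1]; rewrite l1 oppr_gt0 ltr10 in l0.
move=> A AA x tx tx0; have AA' := mulmx1C AA.
have sqA z : sqnorm (z *m A^T) = sqnorm z by rewrite sqnorm_mulmx_orth ?trmxK.
rewrite !gf [LHS](heat_solutionE f_int f_supp x tx0).
rewrite [RHS](heat_solutionE f_int f_supp (x *m A^T) tx0) (sqA x) scalemxAl.
congr (_ * (_ * _)).
(* Half the radius, because the boundary point [x] enters the transform as [2^-1 *: x]. *)
have rho2 : 0 < rho / 2 by exact: divr_gt0.
apply: (laplace_rot_invariant f_int f_ge0 L_ge0 f_supp N_ge1 AA rho2).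
  move=> e e0.
  have /cvgryPgt/(_ e^-1) [n _ /(_ n (leqnn n)) ten] := toy.
  exists (4 * t n)^-1.
    rewrite invr_gt0 mulr_gt0//= invf_plt ?posrE ?mulr_gt0// (lt_le_trans ten)//.
    by rewrite ler_peMl ?ler1n// ltW.
  move=> z zr; have z2r : sqnorm (2 *: z) = rho ^+ 2.
    by rewrite sqnormZ zr; field.
  have bz := sphere _ z2r.
  have bzA : boundary Om ((2 *: z) *m A^T) by apply: sphere; rewrite sqA.
  (* Both [2 *: z] and its rotation lie on the boundary and have equal length, so the level
     condition and cancellation of the common positive factors leave equality of the transforms. *)
  have := lvl n _ bz; rewrite -(lvl n _ bzA).
  rewrite (heat_solution_scaled f_int f_supp (2 *: z) (t0 n)).
  rewrite (heat_solution_scaled f_int f_supp ((2 *: z) *m A^T) (t0 n)) (sqA (2 *: z)).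
  have c0 : (4 * pi * t n) `^ (- (N%:R / 2)) != 0.
    by rewrite gt_eqF// powR_gt0// !mulr_gt0// pi_gt0.
  have exp0 : expR (- (t n * sqnorm (2 *: z) / 4)) != 0 by rewrite expR_eq0.
  have half : 2^-1 *: (2 *: z) = z by rewrite scalerA mulVf// scale1r.
  have halfA : 2^-1 *: ((2 *: z) *m A^T) = z *m A^T by rewrite scalemxAl half.
  by move=> /(mulfI c0)/(mulfI exp0); rewrite half halfA.
by rewrite invr_ge0 mulr_ge0// ltW.
Qed.
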